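(* Let $\alpha>-\tfrac12$ be real, let $l\ge m\ge 0$ be integers, and let $n\in\{0,1,\ldots,m\}$. Define $$S_{n,l,m}^{(\alpha)}(x):=\sum_{j=0}^m w_{\alpha-\frac12,\,\alpha-\frac12,\,-m-1,\,-l-\alpha-\frac12}(j)\; R_n\big(j(j-l-m-\alpha-\tfrac12);\,\alpha-\tfrac12,\alpha-\tfrac12,-m-1,-l-\alpha-\tfrac12\big)\; R_{l+m-2j}^{(\alpha,\alpha)}(x),$$ where $R_k^{(\alpha,\alpha)}$ are the normalized ultraspherical polynomials, $R_n(\,\cdot\,;\alpha,\beta,\gamma,\delta)$ the Racah polynomials and $w_{\alpha,\beta,\gamma,\delta}$ the Racah weights defined in the context. Then, as an identity of polynomials in $x$, $$S_{n,l,m}^{(\alpha)}(x)=\frac{(2\alpha+1)_{l+n}\,(2\alpha+1)_{m+n}\,(\alpha+\frac12)_{l+m}}{2^{2n}\,(\alpha+\frac12)_l\,(\alpha+\frac12)_m\,(2\alpha+1)_{l+m}\,\big((\alpha+1)_n\big)^2}\,(x^2-1)^n\,R_{l-n}^{(\alpha+n,\alpha+n)}(x)\,R_{m-n}^{(\alpha+n,\alpha+n)}(x).$$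
   Context: Shifted factorial: $(a)_0=1$ and $(a)_k=a(a+1)\cdots(a+k-1)$ for $k\ge1$. Normalized Jacobi (ultraspherical when $\alpha=\beta$) polynomials, for integers $k\ge0$: $$R_k^{(\alpha,\beta)}(x)=\frac{P_k^{(\alpha,\beta)}(x)}{P_k^{(\alpha,\beta)}(1)}={}_2F_1\!\left(-k,\,k+\alpha+\beta+1;\,\alpha+1;\,\tfrac12(1-x)\right)=\sum_{i=0}^{k}\frac{(-k)_i\,(k+\alpha+\beta+1)_i}{(\alpha+1)_i\,i!}\left(\frac{1-x}{2}\right)^i ,$$ so $R_k^{(\alpha,\beta)}(1)=1$. Racah polynomials: $$R_n\big(y(y+\gamma+\delta+1);\alpha,\beta,\gamma,\delta\big)={}_4F_3\!\left(-n,\,n+\alpha+\beta+1,\,-y,\,y+\gamma+\delta+1;\ \alpha+1,\,\beta+\delta+1,\,\gamma+1;\ 1\right),$$ with $\gamma=-N-1$, $N$ a nonnegative integer, and $n,y\in\{0,1,\ldots,N\}$; the hypergeometric sum terminates at index $\min(n,y)$. For the parameters used here ($N=m$) this reads $$R_n\big(j(j-l-m-\alpha-\tfrac12);\alpha-\tfrac12,\alpha-\tfrac12,-m-1,-l-\alpha-\tfrac12\big)=\sum_{i=0}^{\min(n,j)}\frac{(-n)_i\,(n+2\alpha)_i\,(-j)_i\,(j-l-m-\alpha-\frac12)_i}{(\alpha+\frac12)_i\,(-l)_i\,(-m)_i\,i!}.$$ Racah weights: $$w_{\alpha,\beta,\gamma,\delta}(y)=\frac{(\alpha+1)_y\,(\beta+\delta+1)_y\,(\gamma+1)_y\,(\gamma+\delta+1)_y}{(-\alpha+\gamma+\delta+1)_y\,(-\beta+\gamma+1)_y\,(\delta+1)_y\,y!}\;\frac{\gamma+\delta+1+2y}{\gamma+\delta+1}.$$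 *)

(* Defs.v *)
From mathcomp Require Import all_boot all_order all_algebra reals.

Set Implicit Arguments.
Unset Strict Implicit.
Unset Printing Implicit Defensive.

Import GRing.Theory Num.Theory.

Local Open Scope ring_scope.

Definition poch {R : realType} (a : R) (k : nat) : R :=
  \prod_(i < k) (a + i%:R).

(* P_k^(a,b) / P_k^(a,b)(1) = 2F1(-k, k+a+b+1; a+1; (1-x)/2), as a polynomial
   in x *)
Definition jacobi_normalized {R : realType} (a b : R) (k : nat) : {poly R} :=
  \sum_(i < k.+1)
    (poch (- k%:R) i * poch (k%:R + a + b + 1) i / (poch (a + 1) i * i`!%:R))
      *: (2^-1 *: (1 - 'X)) ^+ i.

(* R_n(y(y+c+d+1); a, b, c, d), given by y rather than by the quadratic
   argument y(y+c+d+1).  With c = -N-1 and n, y <= N, the 4F3 series stops at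
   min(n, y) <= N.  The cut-off is explicit: beyond it (c+1)_i = (-N)_i can
   vanish in the denominator. *)
Definition racah {R : realType} (a b c d : R) (n y : nat) : R :=
  \sum_(i < (minn n y).+1)
    (poch (- n%:R) i * poch (n%:R + a + b + 1) i
       * poch (- y%:R) i * poch (y%:R + c + d + 1) i)
    / (poch (a + 1) i * poch (b + d + 1) i * poch (c + 1) i * i`!%:R).

Definition racah_weight {R : realType} (a b c d : R) (y : nat) : R :=
  (poch (a + 1) y * poch (b + d + 1) y * poch (c + 1) y * poch (c + d + 1) y)
  / (poch (- a + c + d + 1) y * poch (- b + c + 1) y * poch (d + 1) y
       * y`!%:R)
  * ((c + d + 1 + 2 * y%:R) / (c + d + 1)).

Definition racah_ultraspherical_sum {R : realType} (alpha : R) (n l m : nat) :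
    {poly R} :=
  let a := alpha - 2^-1 in
  let c := - m%:R - 1 in
  let d := - l%:R - alpha - 2^-1 in
  \sum_(j < m.+1)
    (racah_weight a a c d j * racah a a c d n j)
      *: jacobi_normalized alpha alpha (l + m - 2 * j)%N.

(* Main.v *)
(* The ultraspherical operator D = (x^2-1) d^2 + (2 alpha+2) x d acts on
   R_(l+m-2j) as multiplication by an affine function of the Racah argument
   j(j-l-m-alpha-1/2), so the three-term recurrence of the Racah polynomials in
   n becomes a recurrence D S_n = A_n S_(n+1) + B_n S_n + C_n S_(n-1).  By the
   differential equations of the derivatives of f = R_l and g = R_m, the
   functions u_n = (x^2-1)^n f^(n) g^(n) satisfy the same recurrence up to the
   normalization (-l)_n (-m)_n, and A_n never vanishes.  Hence the identity
   reduces to n = 0, which is Dougall's linearization formula for R_l R_m; that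
   one follows by induction on m from the three-term recurrence in the degree.
   Finally f^(n) is a multiple of R_(l-n)^(alpha+n, alpha+n). *)

From HB Require Import structures.
Require Import Defs.
From mathcomp Require Import all_boot all_order all_algebra reals.
From mathcomp Require Import ring lra zify.

Import Order.TTheory GRing.Theory Num.Theory.

Local Open Scope ring_scope.

(** * Shifted factorials *)

Section Pochhammer.
Context {R : realType}.
Implicit Types (a : R) (i k n : nat).

Lemma natS_neq0 k : k%:R + 1 != 0 :> R.
Proof. by rewrite natr1 pnatr_eq0. Qed.

Lemma fact_neq0 k : k`!%:R != 0 :> R.
Proof. by rewrite pnatr_eq0 -lt0n fact_gt0. Qed.

Lemma poch0 a : poch a 0 = 1.
Proof. by rewrite /poch big_ord0. Qed.

Lemma pochSr a k : poch a k.+1 = poch a k * (a + k%:R).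
Proof. by rewrite /poch big_ord_recr. Qed.

Lemma pochSl a k : poch a k.+1 = a * poch (a + 1) k.
Proof.
rewrite /poch big_ord_recl /= addr0; congr (_ * _).
by apply: eq_bigr => i _; rewrite /bump /= natrD addrA.
Qed.

Lemma pochD a k n : poch a (k + n) = poch a k * poch (a + k%:R) n.
Proof.
elim: n => [|n IHn]; first by rewrite addn0 poch0 mulr1.
by rewrite addnS !pochSr IHn natrD; ring.
Qed.

Lemma poch_neq0 a k : (forall i, (i < k)%N -> a + i%:R != 0) -> poch a k != 0.
Proof. by move=> a_neq0; apply/prodf_neq0 => i _; apply: a_neq0. Qed.

Lemma poch_gt0 a k : 0 < a -> 0 < poch a k.
Proof. by move=> a_gt0; apply: prodr_gt0 => i _; rewrite ltr_wpDr. Qed.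

Lemma poch_oppn_eq0 n k : (n < k)%N -> poch (- n%:R : R) k = 0.
Proof.
by move=> ltnk; rewrite /poch (bigD1 (Ordinal ltnk)) //= addNr mul0r.
Qed.

Lemma poch_oppn_neq0 n k : (k <= n)%N -> poch (- n%:R : R) k != 0.
Proof.
move=> lekn; apply: poch_neq0 => i ltik.
by rewrite addrC subr_eq0 eqr_nat ltn_eqF // (leq_trans ltik).
Qed.

Lemma poch_oppnS n k :
  poch (- n.+1%:R : R) k.+1 = - n.+1%:R * poch (- n%:R : R) k.
Proof. by rewrite pochSl; congr (_ * poch _ _); rewrite -natr1; ring. Qed.

Lemma poch_oppn_fact n k :
  (k <= n)%N -> poch (- n%:R : R) k * (n - k)`!%:R = (-1) ^+ k * n`!%:R.
Proof.
elim: k n => [|k IHk] [|n] //= lekn; rewrite ?poch0 ?expr0 ?subn0 //.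
rewrite poch_oppnS subSS -mulrA IHk // factS natrM exprS; ring.
Qed.

End Pochhammer.

(** * Normalized Jacobi polynomials: coefficients and first derivative *)

Section Jacobi.
Context {R : realType}.
Implicit Types (a b : R) (i k n : nat).

Definition jacobi_coef a b k i : R :=
  poch (- k%:R) i * poch (k%:R + a + b + 1) i / (poch (a + 1) i * i`!%:R).

(** The same series in the variable y = (1-x)/2, so that identities can be checked on the
    coefficients of powers of y. *)
Definition jacobi_poly a b k : {poly R} := \poly_(i < k.+1) jacobi_coef a b k i.

Lemma coef_jacobi_poly a b k i : (jacobi_poly a b k)`_i = jacobi_coef a b k i.
Proof.
rewrite coef_poly; case: ltnP => // ltki.
by rewrite /jacobi_coef poch_oppn_eq0 // !mul0r.
Qed.

Lemma jacobi_normalizedE a b k :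
  jacobi_normalized a b k = jacobi_poly a b k \Po (2^-1 *: (1 - 'X)).
Proof.
rewrite /jacobi_poly poly_def linear_sum; apply: eq_bigr => i _ /=.
by rewrite comp_polyZ comp_Xn_poly.
Qed.

Lemma deriv_jacobi_var : (2^-1 *: (1 - 'X) : {poly R})^`() = (- 2^-1)%:P.
Proof.
by rewrite derivZ derivB derivC derivX sub0r scalerN -scaleNr alg_polyC.
Qed.

Lemma jacobi_coefS a b k i : a + 1 + i%:R != 0 ->
  (a + 1 + i%:R) * i.+1%:R * jacobi_coef a b k i.+1 =
  (i%:R - k%:R) * (k%:R + a + b + 1 + i%:R) * jacobi_coef a b k i.
Proof.
move=> ai_neq0; rewrite /jacobi_coef !pochSr factS natrM.
(* As 1/0 = 0, both coefficients vanish if (a+1)_i does. *)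
have [d0|d_neq0] := eqVneq (poch (a + 1) i) 0.
  by rewrite d0 !mul0r invr0 !mulr0.
by field; rewrite d_neq0 fact_neq0 ai_neq0 nat1r pnatr_eq0.
Qed.

Lemma deriv_jacobi a b k : 0 < a + 1 ->
  (jacobi_normalized a b k.+1)^`() =
  (k.+1%:R * (k.+1%:R + a + b + 1) / (2 * (a + 1)))
    *: jacobi_normalized (a + 1) (b + 1) k.
Proof.
move=> a_gt0; rewrite !jacobi_normalizedE deriv_comp deriv_jacobi_var.
have -> : (jacobi_poly a b k.+1)^`() =
    (- (k.+1%:R * (k.+1%:R + a + b + 1) / (a + 1))) *:
      jacobi_poly (a + 1) (b + 1) k.
  apply/polyP => i; rewrite coef_deriv coefZ !coef_jacobi_poly -mulr_natr.
  rewrite /jacobi_coef poch_oppnS !(pochSl _ i) factS natrM.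
  have -> : k.+1%:R + a + b + 1 + 1 = k%:R + (a + 1) + (b + 1) + 1 :> R.
    by rewrite -natr1; ring.
  field; rewrite nat1r !pnatr_eq0 -!lt0n fact_gt0 !gt_eqF ?poch_gt0 //.
  by rewrite addr_gt0.
rewrite comp_polyZ mulrC mul_polyC scalerA; congr (_ *: _).
by field; rewrite gt_eqF // pnatr_eq0.
Qed.

End Jacobi.

(** * Ultraspherical polynomials: differential equation and degree recurrence *)

Section Ultraspherical.
Context {R : realType}.
Implicit Types (alpha : R) (i k n : nat) (p q : {poly R}).

Definition ultra_op alpha p : {poly R} :=
  ('X^2 - 1) * p^`()^`() + (2 * alpha + 2)%:P * 'X * p^`().

Lemma ultra_op_linear alpha : linear (ultra_op alpha).
Proof.
move=> a p q; rewrite /ultra_op !(derivD, derivZ) -!mul_polyC.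
by ring.
Qed.

HB.instance Definition _ alpha :=
  GRing.isLinear.Build R {poly R} {poly R} _ (ultra_op alpha)
    (ultra_op_linear alpha).

Lemma jacobi_var :
  'X = 1 - 2%:P * (2^-1 *: (1 - 'X)) :> {poly R}.
Proof.
rewrite -mul_polyC mulrA -polyCM divff ?pnatr_eq0 // mul1r.
by rewrite opprB addrC subrK.
Qed.

Lemma coefXderiv p i : ('X * p^`())`_i = p`_i * i%:R.
Proof.
by case: i => [|i]; rewrite coefXM /= ?mulr0 // coef_deriv mulr_natr.
Qed.

Lemma ultra_op_jacobi alpha k : 0 < alpha + 1 ->
  ultra_op alpha (jacobi_normalized alpha alpha k) =
  (k%:R * (k%:R + 2 * alpha + 1)) *: jacobi_normalized alpha alpha k.
Proof.
move=> a_gt0; rewrite jacobi_normalizedE.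
set J := jacobi_poly _ _ _; set y : {poly R} := _ *: _.
(* The hypergeometric equation in y, written with the Euler operator y d/dy, which multiplies the
   i-th coefficient by i; on coefficients it is the two-term recurrence [jacobi_coefS]. *)
have odeJ : 'X * ('X * J^`())^`() + (2 * alpha + 1)%:P * ('X * J^`())
          - ('X * J^`()^`() + (alpha + 1)%:P * J^`())
          = (k%:R * (k%:R + 2 * alpha + 1)) *: J.
  apply/polyP => i; rewrite !(coefB, coefD, coefCM, coefZ, coefXderiv).
  have ai_neq0 : alpha + 1 + i%:R != 0 by rewrite gt_eqF // ltr_wpDr.
  rewrite coef_deriv -(mulr_natr _ i.+1) !coef_jacobi_poly.
  have rec := jacobi_coefS alpha alpha k i ai_neq0.
  transitivity (jacobi_coef alpha alpha k i * i%:R * i%:R +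
    (2 * alpha + 1) * (jacobi_coef alpha alpha k i * i%:R) -
    (alpha + 1 + i%:R) * i.+1%:R * jacobi_coef alpha alpha k i.+1).
    by ring.
  by rewrite rec; ring.
rewrite -comp_polyZ -odeJ !(derivM, derivX, derivC).
rewrite !(comp_polyB, comp_polyD, comp_polyM, comp_polyX, comp_polyC).
rewrite /ultra_op !deriv_comp derivM deriv_comp deriv_jacobi_var derivC.
rewrite mulr0 addr0 -/y.
rewrite [in LHS]jacobi_var -/y.
have h2 : 2%:P * (- 2^-1)%:P = -1 :> {poly R}.
  by rewrite -polyCM mulrN divff ?pnatr_eq0 // polyCN.
set A : {poly R} := (J^`()^`() \Po y); set B : {poly R} := (J^`() \Po y).
set c : {poly R} := (- 2^-1)%:P in h2 *.
(* Here c = dy/dx, x = 1 - 2y and x^2 - 1 = 4(y^2 - y), so every chain-rule factor occurs in the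
   form 2c = -1. *)
transitivity ((y * y - y) * A * (2%:P * c) ^+ 2
   - (alpha + 1)%:P * (1 - 2%:P * y) * B * (-(2%:P * c))).
  rewrite !(rmorphD, rmorphM, rmorph1, rmorph_nat) /=.
  by ring.
by rewrite h2; ring.
Qed.

Lemma jacobi_recurrence alpha k : 0 < alpha + 1 ->
  ((2 * k%:R + 2 * alpha + 1)%:P * 'X) * jacobi_normalized alpha alpha k =
  (k%:R + 2 * alpha + 1) *: jacobi_normalized alpha alpha k.+1
  + k%:R *: jacobi_normalized alpha alpha k.-1.
Proof.
move=> a_gt0; rewrite !jacobi_normalizedE.
rewrite {1}jacobi_var.
set J := jacobi_poly _ _; set y : {poly R} := _ *: (_ - _).
have recJ : (2 * k%:R + 2 * alpha + 1)%:P * (J k - 2%:P * ('X * J k)) =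
   (k%:R + 2 * alpha + 1) *: J k.+1 + k%:R *: J k.-1.
  apply/polyP => i; rewrite !(coefD, coefN, coefCM, coefZ, coefXM).
  rewrite !coef_jacobi_poly.
  case: i => [|i] /=.
    by rewrite /jacobi_coef !poch0 fact0 !mulr1 invr1; ring.
  (* The term of index k-1 is rewritten through its parameters 1-k and k+2alpha, which also make
     sense at k = 0; there the factor k kills both sides. *)
  have hk : k%:R * jacobi_coef alpha alpha k.-1 i.+1 =
     k%:R * (poch (1 - k%:R) i.+1 * poch (k%:R + 2 * alpha) i.+1 /
     (poch (alpha + 1) i.+1 * i.+1`!%:R)).
    case: k {J} => [|k]; first by rewrite !mul0r.
    have -> : 1 - k.+1%:R = - k%:R :> R by rewrite -natr1; ring.
    rewrite /jacobi_coef /=.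
    by have -> : k%:R + alpha + alpha + 1 = k.+1%:R + 2 * alpha
      by rewrite -natr1; ring.
  rewrite hk /jacobi_coef (_ : 1 - k%:R = - k%:R + 1 :> R); last by ring.
  rewrite {hk} [k%:R * (_ * _ / _)]mulrA [k%:R * (_ * _)]mulrA.
  have -> : k%:R * poch (- k%:R + 1) i.+1 = - poch (- k%:R : R) i.+2.
    by rewrite [in RHS]pochSl; ring.
  rewrite poch_oppnS.
  have -> : k.+1%:R + alpha + alpha + 1 = k%:R + 2 * alpha + 1 + 1 :> R.
    by rewrite -natr1; ring.
  have -> : k%:R + alpha + alpha + 1 = k%:R + 2 * alpha + 1 :> R by ring.
  rewrite [X in _ = X + _]mulrA [X in _ = X / _ + _]mulrCA -pochSl.
  rewrite [poch (_ + 2 * alpha) _]pochSl !pochSr factS natrM -!natr1.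
  field.
  rewrite natr1 !pnatr_eq0 -!lt0n fact_gt0 !gt_eqF ?poch_gt0 //.
  by rewrite ltr_wpDr.
rewrite -!comp_polyZ -comp_polyD -recJ.
rewrite !(comp_polyB, comp_polyD, comp_polyM, comp_polyX, comp_polyC).
by ring.
Qed.

Section DerivativeODE.
Variables (alpha lam : R) (p : {poly R}).
Hypothesis ode : ultra_op alpha p = lam *: p.

(** Each differentiation keeps the shape of the equation with alpha raised by 1; the eigenvalue
    drops by 2n + 2 + 2alpha at step n, which sums to n(n + 1 + 2alpha). *)
Lemma derivn_ode n :
  ('X^2 - 1) * p^`(n.+2) + (2 * alpha + 2 + 2 * n%:R)%:P * 'X * p^`(n.+1) =
  (lam - n%:R * (n%:R + 2 * alpha + 1))%:P * p^`(n).
Proof.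
elim: n => [|n IHn].
  by rewrite mulr0 addr0 mul0r subr0 [RHS]mul_polyC derivn0 -ode.
have deriv1 : (1 : {poly R})^`() = 0 by rewrite -polyC1 derivC.
have := congr1 (@deriv R) IHn.
rewrite !(derivD, derivM, derivN, derivC, derivX, derivXn, deriv1) -!derivnS.
move=> /eqP; rewrite -subr_eq0 => /eqP dIH.
apply/eqP; rewrite -subr_eq0; apply/eqP; rewrite -[RHS]dIH.
rewrite -[n.+1%:R]natr1 !(rmorphD, rmorphM, rmorphN, rmorph1) /=; ring.
Qed.

End DerivativeODE.

End Ultraspherical.

(** * Products of derivatives under the differential operator *)

Section DerivativeProducts.
Context {R : realType}.
Variables (alpha lam mu : R) (p q : {poly R}).
Hypothesis ode_p : ultra_op alpha p = lam *: p.
Hypothesis ode_q : ultra_op alpha q = mu *: q.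

Definition derivn_prod n : {poly R} := ('X^2 - 1) ^+ n * p^`(n) * q^`(n).

(** Leibniz gives D(pq) = q Dp + p Dq + 2(x^2-1)p'q'. Compared with positive index, the factor
    alpha, which may be zero, is already divided out. *)
Lemma ultra_op_derivn_prod0 :
  ultra_op alpha (derivn_prod 0) =
  (lam + mu) *: derivn_prod 0 + 2 *: derivn_prod 1.
Proof.
rewrite /derivn_prod expr0 !mul1r expr1 !derivn0 !derivn1.
have hp := ode_p; have hq := ode_q; rewrite /ultra_op in hp hq *.
rewrite !derivM !derivD !derivM -!mul_polyC in hp hq *.
transitivity (lam%:P * p * q + mu%:P * q * p +
              2 * (('X^2 - 1) * p^`() * q^`())).
  by rewrite -hp -hq; ring.
by rewrite !(rmorphD, rmorphM, rmorph1) /=; ring.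
Qed.

Lemma ultra_op_derivn_prodS n :
  (n.+1%:R + alpha) *: ultra_op alpha (derivn_prod n.+1) =
  ((n.+1%:R + alpha) * (lam + mu - 2 * n.+1%:R * (n.+1%:R + 2 * alpha)))
    *: derivn_prod n.+1
  + (n.+1%:R + 2 * alpha) *: derivn_prod n.+2
  + (n.+1%:R * (lam - n%:R * (n.+1%:R + 2 * alpha))
             * (mu - n%:R * (n.+1%:R + 2 * alpha))) *: derivn_prod n.
Proof.
have hp := derivn_ode _ _ _ ode_p n.+1; have hq := derivn_ode _ _ _ ode_q n.+1.
have kp := derivn_ode _ _ _ ode_p n; have kq := derivn_ode _ _ _ ode_q n.
have deriv_w : ('X^2 - 1 : {poly R})^`() = 2 * 'X.
  have deriv1 : (1 : {poly R})^`() = 0 by rewrite -polyC1 derivC.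
  by rewrite derivB derivXn deriv1 /= expr1; ring.
rewrite /ultra_op /derivn_prod.
move: deriv_w hp hq kp kq; set w : {poly R} := 'X^2 - 1 => deriv_w.
set P : {poly R} := w ^+ n.
have -> : w ^+ n.+2 = w * (w * P) by rewrite !exprS.
have -> : w ^+ n.+1 = w * P by rewrite exprS.
(* Multiplying by w keeps the exponent n-1 out of the derivative of w^n. *)
have deriv_P : w * P^`() = (2 * n%:R)%:P * 'X * P.
  rewrite /P deriv_exp deriv_w -mulr_natr rmorphM !rmorph_nat.
  case: (n) => [|k /=]; first by ring.
  by rewrite exprS; ring.
have deriv_wP : (w * P)^`() = (2 * n.+1%:R)%:P * ('X * P).
  rewrite derivM deriv_w deriv_P -natr1.
  rewrite !(rmorphM, rmorphD, rmorph1, rmorph_nat).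
  by ring.
rewrite !derivnS; move: (P) deriv_P deriv_wP => {}P deriv_P deriv_wP.
move: (p^`(n)) (q^`(n)) => F G.
rewrite !(deriv_wP, derivM, derivD, derivC, derivX).
move: (P^`()) deriv_P => P1 /eqP; rewrite -subr_eq0 => /eqP eP.
set F1 := F^`(); set F2 := F1^`(); set F3 := F2^`().
set G1 := G^`(); set G2 := G1^`(); set G3 := G2^`().
move=> /eqP; rewrite -subr_eq0 => /eqP hp /eqP; rewrite -subr_eq0 => /eqP hq.
(* Times P, the product of the two equations of order n contains both u_(n+2), through w^2 F2 G2,
   and u_n, through F G. *)
move=> kp kq; have := congr2 *%R kp kq => /eqP; rewrite -subr_eq0 => /eqP kpq.
apply/eqP; rewrite -subr_eq0; apply/eqP.
set a : R := n.+1%:R + alpha.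
move: eP hp hq kpq.
set E1 := (X in X = 0 -> _); set E2 := (X in _ -> X = 0 -> _).
set E3 := (X in _ -> _ -> X = 0 -> _) => eP hp hq.
set E4 := (X in X = 0 -> _) => kpq.
(* E1 removes P', E2 and E3 remove the third derivatives. The multiplier n+1 of E4 is the excess
   2(n+1+alpha) - (n+1+2alpha) in the coefficient of w^2 P F2 G2. *)
transitivity ((a * (2 * n.+1%:R))%:P * 'X * F1 * G1 * E1
    + a%:P * (w * P) * (G1 * E2 + F1 * E3) + n.+1%:R%:P * P * E4).
  rewrite /E1 /E2 /E3 /E4 -!mul_polyC /a -[n.+1%:R]natr1.
  rewrite !(rmorphM, rmorphD, rmorphN, rmorph1, rmorph_nat) /=.
  by ring.
by rewrite eP hp hq kpq; ring.
Qed.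

End DerivativeProducts.

(** * Racah polynomials: three-term recurrence in n *)

Section RacahRecurrence.
Context {R : realType}.
Variables (alpha : R) (l m : nat).

Let h := alpha + 2^-1.

(** The 4F3 summand splits into this factor, free of j, and [racah_basis], free of n, which is a
    Newton-type basis in the Racah argument. *)
Definition racah_coef n i : R :=
  poch (- n%:R) i * poch (n%:R + 2 * alpha) i
  / (poch h i * poch (- l%:R) i * poch (- m%:R) i * i`!%:R).

Definition racah_basis i (j : nat) : R :=
  poch (- j%:R) i * poch (j%:R - l%:R - m%:R - h) i.

Definition ultra_racah n j : R :=
  racah (alpha - 2^-1) (alpha - 2^-1) (- m%:R - 1) (- l%:R - alpha - 2^-1) n j.

(** The range becomes independent of n and j, because (-n)_i or (-j)_i vanishes beyond min(n, j). *)
Lemma ultra_racahE n j : (n <= m)%N ->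
  ultra_racah n j = \sum_(i < m.+1) racah_coef n i * racah_basis i j.
Proof.
move=> lenm; rewrite /ultra_racah /racah.
pose F i := racah_coef n i * racah_basis i j.
have hF i : (poch (- n%:R) i *
    poch (n%:R + (alpha - 2^-1) + (alpha - 2^-1) + 1) i *
    poch (- j%:R) i *
    poch (j%:R + (- m%:R - 1) + (- l%:R - alpha - 2^-1) + 1) i)
   / (poch (alpha - 2^-1 + 1) i *
      poch (alpha - 2^-1 + (- l%:R - alpha - 2^-1) + 1) i *
      poch (- m%:R - 1 + 1) i * i`!%:R) = F i.
  rewrite /F /racah_coef /racah_basis /h.
  have -> : n%:R + (alpha - 2^-1) + (alpha - 2^-1) + 1 = n%:R + 2 * alpha.
    by field.
  have -> : alpha - 2^-1 + 1 = alpha + 2^-1 by field.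
  have -> : alpha - 2^-1 + (- l%:R - alpha - 2^-1) + 1 = - l%:R by field.
  have -> : - m%:R - 1 + 1 = - m%:R :> R by ring.
  have -> : j%:R + (- m%:R - 1) + (- l%:R - alpha - 2^-1) + 1 =
            j%:R - l%:R - m%:R - (alpha + 2^-1) by ring.
  by rewrite -[RHS]mulrAC -!mulrA.
under eq_bigr do rewrite hF.
have leN : ((minn n j).+1 <= m.+1)%N by rewrite ltnS geq_min lenm.
rewrite (big_ord_widen _ F leN) big_mkcond /=.
apply: eq_bigr => i _; case: ltnP => //; rewrite gtn_min => /orP[ltni|ltji].
  by rewrite /F /racah_coef poch_oppn_eq0 // !mul0r.
by rewrite /F /racah_basis poch_oppn_eq0 // mul0r mulr0.
Qed.

Lemma racah_basisS i j :
  racah_basis i.+1 j =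
  (i%:R * (i%:R - l%:R - m%:R - h) - j%:R * (j%:R - l%:R - m%:R - h))
    * racah_basis i j.
Proof. by rewrite /racah_basis !pochSr; ring. Qed.

(* By [racah_basisS], multiplication by the Racah argument j(j-l-m-h) lowers the
   coefficients by one index, in addition to scaling them. *)
Definition racah_coef_pred n i : R := if i is i'.+1 then racah_coef n i' else 0.

Lemma sum_eigen_racah n j : (n < m)%N ->
  j%:R * (j%:R - l%:R - m%:R - h) * ultra_racah n j =
  \sum_(i < m.+1) (i%:R * (i%:R - l%:R - m%:R - h) * racah_coef n i
                   - racah_coef_pred n i) * racah_basis i j.
Proof.
move=> ltnm; rewrite ultra_racahE 1?ltnW //.
under [RHS]eq_bigr do rewrite mulrBl.
rewrite sumrB [X in _ = _ - X]big_ord_recl /= mul0r add0r.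
rewrite mulr_sumr big_ord_recr /= [X in _ = X - _]big_ord_recr /=.
(* The index shift would send the top term to m + 1; it is zero because n < m. *)
have -> : racah_coef n m = 0 by rewrite /racah_coef poch_oppn_eq0 // !mul0r.
rewrite !(mulr0, mul0r) !addr0 -sumrB; apply: eq_bigr => i _.
by rewrite racah_basisS; ring.
Qed.

Hypothesis alpha_gt : - 2^-1 < alpha.
Hypothesis leml : (m <= l)%N.

Lemma half_gt0 : 0 < h.
Proof. have := alpha_gt; rewrite /h => ?; lra. Qed.

Lemma racah_coef_rec0 i : (0 < m)%N -> (i <= m)%N ->
  4 * (i%:R * (i%:R - l%:R - m%:R - h) * racah_coef 0 i - racah_coef_pred 0 i)
  + 2 * l%:R * m%:R * racah_coef 0 i = 2 * l%:R * m%:R * racah_coef 1 i.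
Proof.
move=> m_gt0 leim; have h_neq0 : h != 0 by rewrite gt_eqF // half_gt0.
rewrite /racah_coef_pred; case: i leim => [|[|i]] leim.
- by rewrite /racah_coef !poch0 fact0 !mulr1 invr1; ring.
- have l_neq0 : l%:R != 0 :> R by rewrite pnatr_eq0 -lt0n (leq_trans m_gt0).
  have m_neq0 : m%:R != 0 :> R by rewrite pnatr_eq0 -lt0n.
  rewrite /racah_coef !pochSr !poch0 !fact0 factS fact0; rewrite /h in h_neq0 *.
  by field; rewrite l_neq0 m_neq0 gt_eqF //=; have := alpha_gt; lra.
rewrite /racah_coef (poch_oppn_eq0 0 i.+2) // (poch_oppn_eq0 0 i.+1) //.
by rewrite (poch_oppn_eq0 1 i.+2) // !mul0r; ring.
Qed.

Lemma racah_coef_recS n i : (i <= m)%N ->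
  (n.+1%:R + alpha) *
  (4 * (i%:R * (i%:R - l%:R - m%:R - h) * racah_coef n.+1 i
       - racah_coef_pred n.+1 i)
  + (2 * n.+1%:R * (n.+1%:R + 2 * alpha) + 2 * l%:R * m%:R)
    * racah_coef n.+1 i) =
  (n.+1%:R + 2 * alpha) * (n.+1%:R - l%:R) * (n.+1%:R - m%:R)
    * racah_coef n.+2 i
  + n.+1%:R * (n.+1%:R + 2 * alpha + m%:R) * (n.+1%:R + 2 * alpha + l%:R)
    * racah_coef n i.
Proof.
rewrite /racah_coef_pred; case: i => [|i] leim.
  by rewrite /racah_coef !poch0 fact0 !mulr1 invr1; ring.
have h_gt0 := half_gt0.
have hi_neq0 : h + i%:R != 0 by rewrite gt_eqF // ltr_wpDr.
have il_neq0 : - l%:R + i%:R != 0 :> R.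
  by rewrite addrC subr_eq0 eqr_nat ltn_eqF // (leq_trans leim).
have im_neq0 : - m%:R + i%:R != 0 :> R.
  by rewrite addrC subr_eq0 eqr_nat ltn_eqF.
have hh_neq0 : poch h i != 0 by rewrite gt_eqF // poch_gt0.
have pl_neq0 : poch (- l%:R : R) i != 0.
  by rewrite poch_oppn_neq0 // ltnW // (leq_trans leim).
have pm_neq0 : poch (- m%:R : R) i != 0 by rewrite poch_oppn_neq0 // ltnW.
have f_neq0 : i`!%:R != 0 :> R := fact_neq0 i.
rewrite /racah_coef.
(* All coefficients become rational multiples of N T. The factors n+1 and n+1+2alpha of the
   recurrence complete the shifted factorials of index n and n+2, so nothing is divided by them. *)
set N : R := poch (- n.+1%:R) i; set T := poch (n.+1%:R + 2 * alpha) i.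
have eN2 : poch (- n.+2%:R : R) i.+1 = - n.+2%:R * N by rewrite poch_oppnS.
have eT2 : (n.+1%:R + 2 * alpha) * poch (n.+2%:R + 2 * alpha) i.+1 =
    T * (n.+1%:R + 2 * alpha + i%:R) * (n.+1%:R + 2 * alpha + i.+1%:R).
  rewrite -!pochSr [RHS]pochSl.
  by congr (_ * poch _ _); rewrite -[n.+2%:R]natr1; ring.
have eN0 : n.+1%:R * poch (- n%:R : R) i.+1 =
    - (N * (- n.+1%:R + i%:R) * (- n.+1%:R + i.+1%:R)).
  by rewrite -!pochSr poch_oppnS; ring.
have eT0 : poch (n%:R + 2 * alpha) i.+1 = (n%:R + 2 * alpha) * T.
  by rewrite pochSl /T; congr (_ * poch _ _); rewrite -[n.+1%:R]natr1; ring.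
set D := poch h i.+1 * poch (- l%:R) i.+1 * poch (- m%:R) i.+1 * (i.+1)`!%:R.
rewrite [X in _ = X + _](_ : _ =
  (n.+1%:R - l%:R) * (n.+1%:R - m%:R) * (poch (- n.+2%:R) i.+1 *
   ((n.+1%:R + 2 * alpha) * poch (n.+2%:R + 2 * alpha) i.+1)) / D);
  last by ring.
rewrite [X in _ = _ + X](_ : _ =
  (n.+1%:R + 2 * alpha + m%:R) * (n.+1%:R + 2 * alpha + l%:R) *
   ((n.+1%:R * poch (- n%:R) i.+1) * poch (n%:R + 2 * alpha) i.+1) / D);
  last by ring.
rewrite eN2 eT2 eN0 eT0 /D [poch (- n.+1%:R) i.+1]pochSr.
rewrite [poch (n.+1%:R + _) i.+1]pochSr -/N -/T !pochSr.
rewrite factS natrM -[n.+2%:R]natr1 -![n.+1%:R]natr1 -![i.+1%:R]natr1.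
move: (i`!%:R) f_neq0 => f f_neq0.
rewrite /h in h_gt0 hi_neq0 hh_neq0 *.
field; rewrite natr1 pnatr_eq0 f_neq0 im_neq0 pm_neq0 il_neq0 pl_neq0 hh_neq0.
rewrite andbT /= (_ : _ + i%:R * 2 = (alpha + 2^-1 + i%:R) * 2); last by field.
by rewrite mulf_neq0 ?pnatr_eq0.
Qed.

(* At [n = 0] a common factor [alpha] has been cancelled, so that the relation
   still determines [ultra_racah 1] when [alpha = 0]. *)
Lemma ultra_racah_rec0 j : (0 < m)%N ->
  (4 * (j%:R * (j%:R - l%:R - m%:R - h)) + 2 * l%:R * m%:R) * ultra_racah 0 j
  = 2 * l%:R * m%:R * ultra_racah 1 j.
Proof.
move=> m_gt0.
transitivity (4 * (j%:R * (j%:R - l%:R - m%:R - h) * ultra_racah 0 j) +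
   2 * l%:R * m%:R * ultra_racah 0 j).
  ring.
rewrite sum_eigen_racah // !ultra_racahE //.
rewrite ![_ * (\sum_(i < _) _)]mulr_sumr -big_split /=; apply: eq_bigr => i _.
rewrite [RHS]mulrA -racah_coef_rec0 //; last by rewrite -ltnS.
by rewrite [RHS]mulrDl !mulrA.
Qed.

Lemma ultra_racah_recS n j : (n.+1 < m)%N ->
  (n.+1%:R + alpha) *
  (4 * (j%:R * (j%:R - l%:R - m%:R - h))
   + (2 * n.+1%:R * (n.+1%:R + 2 * alpha) + 2 * l%:R * m%:R))
    * ultra_racah n.+1 j =
  (n.+1%:R + 2 * alpha) * (n.+1%:R - l%:R) * (n.+1%:R - m%:R)
    * ultra_racah n.+2 j
  + n.+1%:R * (n.+1%:R + 2 * alpha + m%:R) * (n.+1%:R + 2 * alpha + l%:R)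
    * ultra_racah n j.
Proof.
move=> ltnm.
set c := _ + 2 * l%:R * m%:R.
rewrite -mulrA [X in _ * X = _]mulrDl -(mulrA 4) sum_eigen_racah //.
have ltnm' := ltnW ltnm.
rewrite !ultra_racahE // 1?ltnW //.
rewrite ![_ * (\sum_(i < _) _)]mulr_sumr -!big_split mulr_sumr /=.
apply: eq_bigr => i _.
rewrite [X in _ = X + _]mulrA [X in _ = _ + X]mulrA -[RHS]mulrDl.
rewrite -racah_coef_recS //; last by rewrite -ltnS.
by rewrite -[RHS]mulrA; congr (_ * _); rewrite [RHS]mulrDl !mulrA.
Qed.

End RacahRecurrence.

(** * Dougall's linearization formula and the Racah weights *)

Section Linearization.
Context {R : realType}.
Variable h : R.
Hypothesis h_gt0 : 0 < h.

Let S k : {poly R} := jacobi_normalized (h - 2^-1) (h - 2^-1) k.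

Definition geg_fact k : R := poch h k / k`!%:R.
(** With k = l+m-j, the last factor of (h)_(k+1) is the denominator l+m-j+h of Dougall's formula. *)
Definition geg_ratio k : R := poch (2 * h) k / poch h k.+1.
Notation A := geg_fact.
Notation B := geg_ratio.

Lemma geg_factS k : A k.+1 = A k * (h + k%:R) / (k%:R + 1).
Proof.
rewrite /A pochSr factS natrM -natr1; field.
by rewrite natS_neq0 fact_neq0.
Qed.

Lemma hD_neq0 k : h + k%:R != 0.
Proof. by rewrite gt_eqF // ltr_wpDr. Qed.

Lemma geg_ratioS k : B k.+1 = B k * (2 * h + k%:R) / (h + k%:R + 1).
Proof.
have := hD_neq0 k.+1; rewrite -natr1 addrA => hk.
rewrite /B pochSr [poch h k.+2]pochSr -[k.+1%:R]natr1 addrA; field.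
by rewrite hk gt_eqF // poch_gt0.
Qed.

Lemma geg_fact0 : A 0 = 1.
Proof. by rewrite /A poch0 divr1. Qed.

Lemma geg_fact_neq0 k : A k != 0.
Proof. by rewrite gt_eqF // divr_gt0 ?poch_gt0 // ltr0n fact_gt0. Qed.

Lemma geg_ratio_neq0 k : B k != 0.
Proof. by rewrite gt_eqF // divr_gt0 ?poch_gt0 // mulr_gt0. Qed.

(* Dougall: the coefficient of [R_(l+m-2j)] in the product of the Gegenbauer
   polynomials of parameter [h] and degrees [l] and [m], divided by
   [l+m-2j+h]. *)
Definition lin_coef l m j : R :=
  A j * A (m - j)%N * A (l - j)%N * B (l + m - j)%N.
Notation E := lin_coef.

(* [lin_coef_mid] with [m = p + j + 1] and [l = q + j + 1]. *)
Lemma geg_rec j p q :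
  (j%:R + p%:R + 2) * (A j.+1 * A p.+1 * A q * B (p + q + j).+2
     * (p%:R + q%:R + 1 + h)) =
  (j%:R + p%:R + 1 + h) *
    (A j.+1 * A p * A q * B (p + q + j).+1 * (p%:R + q%:R + 2 * h)
     + A j * A p.+1 * A q.+1 * B (p + q + j).+2 * (p%:R + q%:R + 2))
  - (j%:R + p%:R + 2 * h) *
    (A j * A p * A q.+1 * B (p + q + j).+1 * (p%:R + q%:R + 1 + h)).
Proof.
have hs := hD_neq0 (p + q + j).+2.
rewrite (geg_ratioS (p + q + j).+1) !geg_factS.
rewrite -[(p + q + j).+2%:R]natr1 -[(p + q + j).+1%:R]natr1 !natrD in hs *.
by field; rewrite !natS_neq0 /= andbT -addrA.
Qed.

(** Compares the coefficients of R_(l+m-1-2j) when [gegenbauer_rec] at m is multiplied by C_l.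
    Writing m and l through p and q removes all truncated subtractions. *)
Lemma lin_coef_mid l m j : (j < m)%N -> (m < l)%N ->
  (m%:R + 1) * (E l m.+1 j.+1 * ((l + m.+1 - 2 * j.+1)%N%:R + h)) =
  (m%:R + h) * (E l m j.+1 * ((l + m - 2 * j.+1)%N%:R + 2 * h)
              + E l m j * (l + m - 2 * j)%N%:R)
  - (m%:R - 1 + 2 * h) * (E l m.-1 j * ((l + m.-1 - 2 * j)%N%:R + h)).
Proof.
move=> ltjm ltml.
pose p := (m - j.+1)%N; pose q := (l - j.+1)%N.
have {ltjm} em : m = (p + j).+1 by rewrite /p; lia.
have {ltml} el : l = (q + j).+1 by rewrite /q; lia.
rewrite em el {em el} /E.
have -> : ((p + j).+2 - j.+1 = p.+1)%N by lia.
have -> : ((p + j).+1 - j.+1 = p)%N by lia.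
have -> : ((p + j).+1 - j = p.+1)%N by lia.
have -> : ((q + j).+1 - j.+1 = q)%N by lia.
have -> : ((q + j).+1 - j = q.+1)%N by lia.
have -> : ((p + j).+1.-1 - j = p)%N by lia.
have -> : ((q + j).+1 + (p + j).+2 - j.+1 = (p + q + j).+2)%N by lia.
have -> : ((q + j).+1 + (p + j).+1 - j.+1 = (p + q + j).+1)%N by lia.
have -> : ((q + j).+1 + (p + j).+1 - j = (p + q + j).+2)%N by lia.
have -> : ((q + j).+1 + (p + j).+1.-1 - j = (p + q + j).+1)%N by lia.
have -> : ((q + j).+1 + (p + j).+2 - 2 * j.+1 = p + q + 1)%N by lia.
have -> : ((q + j).+1 + (p + j).+1 - 2 * j.+1 = p + q)%N by lia.
have -> : ((q + j).+1 + (p + j).+1 - 2 * j = p + q + 2)%N by lia.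
have -> : ((q + j).+1 + (p + j).+1.-1 - 2 * j = p + q + 1)%N by lia.
rewrite -natr1 !natrD.
have -> : p%:R + j%:R + 1 + 1 = j%:R + p%:R + 2 :> R by ring.
have -> : p%:R + j%:R + 1 + h = j%:R + p%:R + 1 + h by ring.
have -> : p%:R + j%:R + 1 - 1 + 2 * h = j%:R + p%:R + 2 * h by ring.
exact: geg_rec.
Qed.

(** Boundary cases of the same comparison: the top degree l+m+1 here, and the bottom degree l-m-1 in
    [lin_coef_last], each receive a single term, from x C_l C_m. *)
Lemma lin_coef_first l m :
  (m%:R + 1) * (E l m.+1 0 * ((l + m.+1 - 2 * 0)%N%:R + h)) =
  (m%:R + h) * (E l m 0 * ((l + m - 2 * 0)%N%:R + 2 * h)).
Proof.
rewrite /E !subn0 addnS geg_factS geg_ratioS.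
have hs := hD_neq0 (l + m).+1.
rewrite -natr1 natrD in hs *.
by field; rewrite natS_neq0 /= andbT -addrA.
Qed.

Lemma lin_coef_last l m : (m < l)%N ->
  (m%:R + 1) * (E l m.+1 m.+1 * ((l + m.+1 - 2 * m.+1)%N%:R + h)) =
  (m%:R + h) * (E l m m * (l + m - 2 * m)%N%:R).
Proof.
move=> ltml; pose q := (l - m.+1)%N.
have {ltml} -> : l = (q + m).+1 by rewrite /q; lia.
rewrite /E !subnn.
have -> : ((q + m).+1 - m.+1 = q)%N by lia.
have -> : ((q + m).+1 - m = q.+1)%N by lia.
have -> : ((q + m).+1 + m.+1 - m.+1 = (q + m).+1)%N by lia.
have -> : ((q + m).+1 + m - m = (q + m).+1)%N by lia.
have -> : ((q + m).+1 + m.+1 - 2 * m.+1 = q)%N by lia.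
have -> : ((q + m).+1 + m - 2 * m = q.+1)%N by lia.
rewrite !geg_factS -natr1.
by field; rewrite !natS_neq0.
Qed.

Definition gegenbauer k : {poly R} := (poch (2 * h) k / k`!%:R) *: S k.
Notation C := gegenbauer.

(** The convention C_(-1) = 0 is needed at k = 0, where the coefficient k-1+2h of the recurrence
    need not vanish. *)
Definition gegenbauer_pred k : {poly R} := if k is k'.+1 then C k' else 0.

Lemma gegenbauer_rec k :
  (k%:R + 1) *: C k.+1 =
  (2 * (k%:R + h))%:P * 'X * C k
   - (k%:R - 1 + 2 * h) *: gegenbauer_pred k.
Proof.
have a_gt0 : 0 < h - 2^-1 + 1 by have := h_gt0 => ?; lra.
have recS := jacobi_recurrence (h - 2^-1) k a_gt0; rewrite -/(S _) in recS.
have -> : (2 * (k%:R + h))%:P * 'X * C k =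
    (poch (2 * h) k / k`!%:R)
      *: ((2 * k%:R + 2 * (h - 2^-1) + 1)%:P * 'X * S k).
  rewrite /C -!mul_polyC mulrCA; congr (_ * (_%:P * _ * _)).
  by field.
rewrite recS /C -!mul_polyC.
have -> : k%:R + 2 * (h - 2^-1) + 1 = k%:R + 2 * h by field.
rewrite mulrDr !mulrA -!polyCM.
case: k {recS} => [|k]; rewrite /gegenbauer_pred.
  rewrite !mulr0 subr0 polyC0 mul0r addr0; congr (_%:P * _).
  by rewrite pochSr poch0 !fact0 factS fact0; field.
rewrite /C -mul_polyC [_%:P * (_%:P * _)]mulrA -polyCM.
have -> : (k.+1%:R + 1) * (poch (2 * h) k.+2 / (k.+2)`!%:R) =
   poch (2 * h) k.+1 / k.+1`!%:R * (k.+1%:R + 2 * h).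
  rewrite pochSr (factS k.+1) natrM -[k.+2%:R]natr1; field.
  by rewrite fact_neq0 [1 + k%:R]addrC !natr1 pnatr_eq0.
have -> : (k.+1%:R - 1 + 2 * h) * (poch (2 * h) k / k`!%:R) =
   poch (2 * h) k.+1 / k.+1`!%:R * k.+1%:R.
  rewrite pochSr (factS k) natrM -[k.+1%:R]natr1; field.
  by rewrite fact_neq0 natS_neq0.
by rewrite addrK.
Qed.

Lemma gegenbauer_linearization l m : (m <= l)%N ->
  C l * C m = \sum_(j < m.+1)
    (E l m j * ((l + m - 2 * j)%N%:R + h)) *: S (l + m - 2 * j).
Proof.
move=> leml.
(* The recurrence has order two, so the induction carries m and m-1 together; at m = 0 the second
   sum is empty, in accordance with C_(-1) = 0. *)
suff : C l * C m = \sum_(j < m.+1)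
    (E l m j * ((l + m - 2 * j)%N%:R + h)) *: S (l + m - 2 * j) /\
  C l * gegenbauer_pred m = \sum_(j < m)
    (E l m.-1 j * ((l + m.-1 - 2 * j)%N%:R + h)) *: S (l + m.-1 - 2 * j).
  by case.
elim: m leml => [|m IHm] ltml.
  rewrite big_ord_recl !big_ord0 addr0 mulr0 muln0 subn0 addn0; split=> //.
  have S0 : S 0 = 1.
    by rewrite /S /jacobi_normalized big_ord_recl big_ord0 !poch0 expr0 addr0
               fact0 !mulr1 divr1 scale1r.
  rewrite {2}/C S0 poch0 fact0 divr1 scale1r mulr1 /C; congr (_ *: _).
  rewrite /E !subn0 addn0 geg_fact0 !mul1r /A /B pochSr.
  by field; rewrite hD_neq0 fact_neq0 gt_eqF // poch_gt0.
have [IH1 IH2] := IHm (ltnW ltml); split; last by [].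
have m1_neq0 : m%:R + 1 != 0 :> R := natS_neq0 m.
apply: (scalerI m1_neq0).
rewrite scalerAr gegenbauer_rec mulrBr.
rewrite -[X in _ - X]scalerAr IH2 [C l * _]mulrCA.
have a_gt0 : 0 < h - 2^-1 + 1 by have := h_gt0 => ?; lra.
(* Each x R_k is expanded by the degree recurrence: the first sum collects the raised degrees, the
   second the lowered ones. *)
have -> : (2 * (m%:R + h))%:P * 'X * (C l * C m) =
   \sum_(j < m.+1) ((m%:R + h) * (E l m j * ((l + m - 2 * j)%N%:R + 2 * h)))
       *: S (l + m.+1 - 2 * j)
 + \sum_(j < m.+1) ((m%:R + h) * (E l m j * (l + m - 2 * j)%N%:R))
       *: S (l + m.+1 - 2 * j.+1).
  rewrite IH1 mulr_sumr -big_split; apply: eq_bigr => j _ /=.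
  have lejm : (j <= m)%N by rewrite -ltnS.
  have -> : (l + m.+1 - 2 * j = (l + m - 2 * j).+1)%N by lia.
  have -> : (l + m.+1 - 2 * j.+1 = (l + m - 2 * j).-1)%N by lia.
  have := jacobi_recurrence (h - 2^-1) (l + m - 2 * j)%N a_gt0.
  rewrite -!/(S _); move: (l + m - 2 * j)%N => k recS.
  transitivity (((m%:R + h) * E l m j) *:
    ((2 * k%:R + 2 * (h - 2^-1) + 1)%:P * 'X * S k)).
    have -> : 2 * k%:R + 2 * (h - 2^-1) + 1 = 2 * (k%:R + h) by field.
    by rewrite -!mul_polyC !polyCM; ring.
  have eqh : k%:R + 2 * (h - 2^-1) + 1 = k%:R + 2 * h by field.
  by rewrite recS eqh scalerDr !scalerA -!mulrA.
(* The extreme degrees are split off; the interior terms are then matched by [lin_coef_mid]. *)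
rewrite !scaler_sumr [in RHS]big_ord_recl [in RHS]big_ord_recr.
rewrite [X in X + _ - _ = _]big_ord_recl [X in _ + X - _ = _]big_ord_recr /=.
rewrite !scalerA lin_coef_first lin_coef_last //.
set T0 := (_ * (E l m 0 * _)) *: _; set T1 := (_ * (E l m m * _)) *: _.
rewrite !addrA [LHS]addrAC; congr (_ + _).
rewrite -!addrA; congr (_ + _).
rewrite addrA -big_split -sumrB; apply: eq_bigr => j _ /=.
rewrite [bump 0 j]add1n [RHS]scalerA lin_coef_mid //.
have -> : (l + m.-1 - 2 * j = l + m.+1 - 2 * j.+1)%N by have := ltn_ord j; lia.
by rewrite scalerA -scalerDl -scalerBl -mulrDr [m%:R + (_ + _)]addrA.
Qed.

(** The Racah weights are Dougall's coefficients normalized at j = 0: both sides equal 1 there and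
    have the same ratio of consecutive terms in j. *)
Lemma racah_weightE l m j : (j <= m)%N -> (m <= l)%N ->
  racah_weight (h - 1) (h - 1) (- m%:R - 1) (- l%:R - h) j =
  E l m j * ((l + m - 2 * j)%N%:R + h) / (E l m 0 * ((l + m)%N%:R + h)).
Proof.
move=> lejm leml; rewrite /racah_weight.
have -> : h - 1 + 1 = h by ring.
have -> : h - 1 + (- l%:R - h) + 1 = - l%:R by ring.
have -> : - m%:R - 1 + 1 = - m%:R :> R by ring.
have -> : - m%:R - 1 + (- l%:R - h) + 1 = - (l%:R + m%:R + h) by ring.
have -> : - (h - 1) + (- m%:R - 1) + (- l%:R - h) + 1 =
    1 - (l%:R + m%:R + 2 * h).
  by ring.
have -> : - (h - 1) + (- m%:R - 1) + 1 = 1 - (m%:R + h) by ring.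
have -> : - l%:R - h + 1 = 1 - (l%:R + h) by ring.
have lm_neq0 := hD_neq0 (l + m); rewrite natrD in lm_neq0.
have E_neq0 i : E l m i != 0.
  apply: mulf_neq0; last exact: geg_ratio_neq0.
  by do 2 ![apply: mulf_neq0; last exact: geg_fact_neq0]; exact: geg_fact_neq0.
have -> : poch h j * poch (- l%:R) j * poch (- m%:R) j *
    poch (- (l%:R + m%:R + h)) j /
    (poch (1 - (l%:R + m%:R + 2 * h)) j * poch (1 - (m%:R + h)) j *
     poch (1 - (l%:R + h)) j * j`!%:R) = E l m j / E l m 0.
  elim: j lejm => [|j IHj] ltjm.
    by rewrite !poch0 fact0 !mulr1 divr1 divff ?E_neq0.
  pose p := (m - j.+1)%N; pose q := (l - j.+1)%N.
  have em : m = (p + j.+1)%N by rewrite /p; lia.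
  have el : l = (q + j.+1)%N by rewrite /q; lia.
  have := IHj (ltnW ltjm).
  have -> : E l m j = E l m j.+1 * ((j%:R + 1) * (h + p%:R) * (h + q%:R)
      * (2 * h + p%:R + q%:R + j%:R + 1))
      / ((h + j%:R) * (p%:R + 1) * (q%:R + 1) * (h + p%:R + q%:R + j%:R + 2)).
    rewrite /E em el.
    have -> : (p + j.+1 - j.+1 = p)%N by lia.
    have -> : (q + j.+1 - j.+1 = q)%N by lia.
    have -> : (p + j.+1 - j = p.+1)%N by lia.
    have -> : (q + j.+1 - j = q.+1)%N by lia.
    have -> : (q + j.+1 + (p + j.+1) - j.+1 = (p + q + j).+1)%N by lia.
    have -> : (q + j.+1 + (p + j.+1) - j = (p + q + j).+2)%N by lia.
    rewrite (geg_ratioS (p + q + j).+1) !geg_factS.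
    have hs := hD_neq0 (p + q + j).+2; have hj := hD_neq0 j.
    rewrite -[(p + q + j).+2%:R]natr1 -[(p + q + j).+1%:R]natr1 !natrD in hs *.
    field; rewrite hj !natS_neq0 !andbT.
    by rewrite (_ : _ + 2 = h + (p%:R + q%:R + j%:R + 1 + 1)) //; ring.
  set W := _ / _ => eqW.
  transitivity (W * ((h + j%:R) * (- l%:R + j%:R) * (- m%:R + j%:R) *
     (- (l%:R + m%:R + h) + j%:R) /
    ((1 - (l%:R + m%:R + 2 * h) + j%:R) * (1 - (m%:R + h) + j%:R) *
     (1 - (l%:R + h) + j%:R) * (j%:R + 1)))).
    rewrite mulf_div !pochSr factS natrM -[j.+1%:R]natr1.
    by congr (_ / _); ring.
  rewrite eqW em el -em -el.
  have -> : l%:R = q%:R + j%:R + 1 :> R by rewrite el natrD -natr1 addrA.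
  have -> : m%:R = p%:R + j%:R + 1 :> R by rewrite em natrD -natr1 addrA.
  have hpq_neq0 : 2 * h + (p + q + j).+1%:R != 0.
    by rewrite gt_eqF // ltr_wpDr // mulr_gt0.
  have hs := hD_neq0 (p + q + j).+2.
  rewrite -[(p + q + j).+2%:R]natr1 -[(p + q + j).+1%:R]natr1 !natrD
    in hs hpq_neq0.
  field; rewrite !natS_neq0 E_neq0 hD_neq0 !andbT /=.
  rewrite (_ : 1 - (q%:R + _ + _ + _) + _ = - (h + q%:R)); last by ring.
  rewrite (_ : 1 - (p%:R + _ + _ + _) + _ = - (h + p%:R)); last by ring.
  rewrite (_ : 1 - _ + _ = - (2 * h + (p%:R + q%:R + j%:R + 1))); last by ring.
  rewrite (_ : _ + 2 = h + (p%:R + q%:R + j%:R + 1 + 1)); last by ring.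
  by rewrite !oppr_eq0 !hD_neq0 hs hpq_neq0.
(* What remains is (l+m-2j+h)/(l+m+h), whose numerator and denominator both appear negated in the
   weight. *)
rewrite -[RHS]mulf_div; congr (_ * _).
have -> : (l + m - 2 * j)%N%:R = l%:R + m%:R - 2 * j%:R :> R.
  by rewrite natrB; [rewrite natrD natrM | lia].
by rewrite natrD; field; rewrite addrC.
Qed.

End Linearization.

(** Each derivative lowers the degree k by 1 and raises alpha by 1, so k+2alpha+1 grows by 1 and the
    constants of [deriv_jacobi] multiply to shifted factorials. *)
Lemma derivn_jacobi {R : realType} (alpha : R) d n : 0 < alpha + 1 ->
  (jacobi_normalized alpha alpha (n + d))^`(n) =
  ((n + d)`!%:R / d`!%:R * poch ((n + d)%N%:R + 2 * alpha + 1) n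
     / (2 ^+ n * poch (alpha + 1) n))
  *: jacobi_normalized (alpha + n%:R) (alpha + n%:R) d.
Proof.
elim: n alpha => [|n IHn] alpha a_gt0.
  rewrite derivn0 add0n !poch0 expr0 !mulr1 divr1 divff ?scale1r ?addr0 //.
  by rewrite fact_neq0.
rewrite derivSn addSn deriv_jacobi // derivnZ IHn; last by rewrite addr_gt0.
have -> : alpha + 1 + n%:R = alpha + n.+1%:R by rewrite -natr1; ring.
rewrite scalerA; congr (_ *: _).
rewrite factS natrM [poch _ n.+1]pochSl exprS [poch (alpha + 1) _]pochSl.
have -> : (n + d)%N%:R + 2 * (alpha + 1) + 1 =
    (n + d).+1%:R + 2 * alpha + 1 + 1.
  by rewrite -natr1; ring.
have pa : 0 < poch (alpha + 1 + 1) n by rewrite poch_gt0 // addr_gt0.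
field; rewrite fact_neq0 !gt_eqF //.
by rewrite exprn_gt0.
Qed.

(** * The Racah sum as a multiple of the products of derivatives *)

Section Expansion.
Context {R : realType}.
Variables (alpha : R) (l m : nat).
Hypothesis alpha_gt : - 2^-1 < alpha.
Hypothesis leml : (m <= l)%N.

Let a_gt0 : 0 < alpha + 1.
Proof. have := alpha_gt => ?; lra. Qed.

Let S k : {poly R} := jacobi_normalized alpha alpha k.
Let w j := racah_weight (alpha - 2^-1) (alpha - 2^-1)
             (- m%:R - 1) (- l%:R - alpha - 2^-1) j.
Let T n : {poly R} := racah_ultraspherical_sum alpha n l m.
Let u := derivn_prod (S l) (S m).
Let lam k : R := k%:R * (k%:R + 2 * alpha + 1).

Let TE n : T n = \sum_(j < m.+1)
  (w j * ultra_racah alpha l m n j) *: S (l + m - 2 * j).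
Proof. by []. Qed.

(** With k = l+m-2j, the eigenvalue k(k+2alpha+1) is 4j(j-l-m-alpha-1/2) plus a constant; the
    constant is its value at j = 0. *)
Lemma ultra_op_racah_sum n : ultra_op alpha (T n) =
  \sum_(j < m.+1) (w j * ((4 * (j%:R * (j%:R - l%:R - m%:R - (alpha + 2^-1)))
      + (lam l + lam m + 2 * l%:R * m%:R)) * ultra_racah alpha l m n j))
    *: S (l + m - 2 * j).
Proof.
rewrite TE linear_sum; apply: eq_bigr => j _ /=.
rewrite linearZ /= ultra_op_jacobi // scalerA; congr (_ *: _).
rewrite -[LHS]mulrA; congr (_ * _); rewrite mulrC; congr (_ * _).
rewrite natrB; last by have := ltn_ord j; lia.
by rewrite natrD natrM /lam; field.
Qed.

Lemma ultra_op_racah_sum0 : (0 < m)%N ->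
  ultra_op alpha (T 0) = (lam l + lam m) *: T 0 + (2 * l%:R * m%:R) *: T 1.
Proof.
move=> m_gt0; rewrite ultra_op_racah_sum !TE !scaler_sumr -big_split /=.
apply: eq_bigr => j _; rewrite !scalerA -scalerDl; congr (_ *: _).
rewrite [X in _ = _ + X]mulrCA -ultra_racah_rec0 // [X in _ = X + _]mulrCA.
rewrite -[RHS]mulrDr.
congr (_ * _); move: (ultra_racah _ _ _ _ _) => x; ring.
Qed.

Lemma ultra_op_racah_sumS n : (n.+1 < m)%N ->
  (n.+1%:R + alpha) *: ultra_op alpha (T n.+1) =
  ((n.+1%:R + alpha) * (lam l + lam m - 2 * n.+1%:R * (n.+1%:R + 2 * alpha)))
    *: T n.+1
  + ((n.+1%:R + 2 * alpha) * (n.+1%:R - l%:R) * (n.+1%:R - m%:R)) *: T n.+2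
  + (n.+1%:R * (n.+1%:R + 2 * alpha + m%:R) * (n.+1%:R + 2 * alpha + l%:R))
    *: T n.
Proof.
move=> ltnm; rewrite ultra_op_racah_sum !TE !scaler_sumr -!big_split /=.
apply: eq_bigr => j _; rewrite !scalerA -!scalerDl; congr (_ *: _).
rewrite -[RHS]addrA [X in _ = X + _]mulrCA [X in _ = _ + (X + _)]mulrCA.
rewrite [X in _ = _ + (_ + X)]mulrCA -[X in _ = _ + X]mulrDr.
rewrite -ultra_racah_recS //.
rewrite -[RHS]mulrDr [LHS]mulrCA; congr (_ * _).
move: (ultra_racah _ _ _ _ _) => x; ring.
Qed.

Let h := alpha + 2^-1.

(** The reciprocal of the coefficient of R_(l+m) in Dougall's expansion of R_l R_m. *)
Definition lin_const : R :=
  poch (2 * h) l / l`!%:R * (poch (2 * h) m / m`!%:R)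
    / (lin_coef h l m 0 * ((l + m)%N%:R + h)).

Lemma racah_sum_base : T 0 = lin_const *: u 0.
Proof.
have h_gt0 : 0 < h by rewrite /h; have := alpha_gt => ?; lra.
have hE : h - 2^-1 = alpha by rewrite /h addrK.
have := gegenbauer_linearization _ h_gt0 l m leml.
rewrite /gegenbauer hE -!/(S _) => linE.
rewrite /u /derivn_prod expr0 mul1r !derivn0 /lin_const mulrC -scalerA.
have -> : (poch (2 * h) l / l`!%:R * (poch (2 * h) m / m`!%:R)) *: (S l * S m) =
   (poch (2 * h) l / l`!%:R) *: S l * ((poch (2 * h) m / m`!%:R) *: S m).
  by rewrite -scalerAl -scalerAr scalerA.
rewrite linE TE scaler_sumr; apply: eq_bigr => j _.
rewrite scalerA; congr (_ *: _).
have -> : ultra_racah alpha l m 0 j = 1.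
  rewrite /ultra_racah /racah min0n big_ord_recl big_ord0 !poch0 fact0.
  by rewrite !mulr1 divr1 addr0.
rewrite mulr1 /w.
have -> : alpha - 2^-1 = h - 1 by rewrite /h; field.
have -> : - l%:R - alpha - 2^-1 = - l%:R - h by rewrite /h; ring.
have lejm : (j <= m)%N by rewrite -ltnS.
rewrite (racah_weightE _ h_gt0 _ _ _ lejm leml); exact: mulrC.
Qed.

Lemma racah_sum_derivn_prod n : (n <= m)%N ->
  (poch (- l%:R) n * poch (- m%:R) n) *: T n = lin_const *: u n.
Proof.
have odel : ultra_op alpha (S l) = lam l *: S l by rewrite ultra_op_jacobi.
have odem : ultra_op alpha (S m) = lam m *: S m by rewrite ultra_op_jacobi.
have base : (poch (- l%:R) 0 * poch (- m%:R) 0) *: T 0 = lin_const *: u 0.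
  by rewrite !poch0 mulr1 scale1r racah_sum_base.
have [m0|m_gt0] := posnP m.
  by move=> lenm; have -> : n = 0%N by lia.
(* The recurrence has order two, so two consecutive indices are carried; index n+1 is claimed only
   while n < m. *)
suff: (n <= m)%N ->
   (poch (- l%:R) n * poch (- m%:R) n) *: T n = lin_const *: u n /\
   ((n < m)%N -> (poch (- l%:R) n.+1 * poch (- m%:R) n.+1) *: T n.+1
       = lin_const *: u n.+1).
  by move=> IH /IH[].
elim: n => [|n IHn] lenm; split=> //.
(* Apply D to the base identity: the terms with lam l + lam m cancel and leave the identity at index
   1. *)
- move=> _; apply: (@scalerI R _ 2); first by rewrite pnatr_eq0.
  have : ultra_op alpha (T 0) = lin_const *: ultra_op alpha (u 0).
    by rewrite racah_sum_base linearZ.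
  rewrite ultra_op_racah_sum0 // (ultra_op_derivn_prod0 _ _ _ _ _ odel odem).
  rewrite racah_sum_base scalerDr [X in X + _ = _]scalerA.
  rewrite [X in _ = X + _]scalerA [lin_const * (_ + _)]mulrC => /addrI eq1.
  transitivity ((2 * l%:R * m%:R) *: T 1).
    by rewrite scalerA; congr (_ *: _); rewrite !pochSr !poch0; ring.
  by rewrite eq1 scalerA [RHS]scalerA [2 * _]mulrC.
- by case: (IHn (ltnW lenm)) => _; apply.
have [IH1 /(_ lenm) IH2] := IHn (ltnW lenm).
(* This is the part of the leading coefficient left once n+1-l and n+1-m are absorbed into
   (-l)_(n+2) and (-m)_(n+2). *)
move=> ltnm; have n2a_neq0 : n.+1%:R + 2 * alpha != 0.
  have := alpha_gt; have : 1 <= n.+1%:R :> R by rewrite ler1n.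
  by move=> *; rewrite gt_eqF //; lra.
apply: (scalerI n2a_neq0).
have HT := ultra_op_racah_sumS n ltnm.
have Hu := ultra_op_derivn_prodS _ _ _ _ _ odel odem n.
rewrite -/u in Hu.
have /(congr1 (fun p => (n.+1%:R + alpha) *: ultra_op alpha p)) := IH2.
rewrite !linearZ /= HT Hu.
move: IH1 IH2; rewrite !(pochSr _ n.+1) !(pochSr _ n).
move: (T n) (T n.+1) (T n.+2) (u n) (u n.+1) (u n.+2) => T0 T1 T2 u0 u1 u2.
move: (poch (- l%:R) n) (poch (- m%:R) n) lin_const => cl cm K.
rewrite -!mul_polyC => /eqP; rewrite -subr_eq0; set E0 := _ - _ => /eqP e0.
move=> /eqP; rewrite -subr_eq0; set E1 := _ - _ => /eqP e1.
move=> /eqP; rewrite -subr_eq0; set E2 := _ - _ => /eqP e2.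
apply/eqP; rewrite -subr_eq0; apply/eqP.
(* The two recurrences match because lam l - n(n+1+2alpha) = (l-n)(l+n+1+2alpha), and likewise for
   m: the factors l-n and m-n account for passing from (-l)_n (-m)_n to index n+1. *)
transitivity (E2
  - ((n.+1%:R + alpha)
       * (lam l + lam m - 2 * n.+1%:R * (n.+1%:R + 2 * alpha)))%:P * E1
  - (n.+1%:R * (lam l - n%:R * (n.+1%:R + 2 * alpha))
             * (lam m - n%:R * (n.+1%:R + 2 * alpha)))%:P * E0); last first.
  by rewrite e0 e1 e2; ring.
rewrite /E0 /E1 /E2 /lam -[n.+1%:R]natr1.
rewrite !(rmorphM, rmorphD, rmorphN, rmorph1, rmorph_nat) /=.
ring.
Qed.

End Expansion.

(** * The closed form with its explicit constant *)

Theorem theorem4p1 (R : realType) (alpha : R) (l m n : nat)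
    (halpha : - 2^-1 < alpha) (hml : (m <= l)%N) (hnm : (n <= m)%N) :
  racah_ultraspherical_sum alpha n l m =
    ((poch (2 * alpha + 1) (l + n) * poch (2 * alpha + 1) (m + n)
        * poch (alpha + 2^-1) (l + m))
     / (2 ^+ (2 * n) * poch (alpha + 2^-1) l * poch (alpha + 2^-1) m
          * poch (2 * alpha + 1) (l + m) * poch (alpha + 1) n ^+ 2))
    *: (('X^2 - 1) ^+ n
          * jacobi_normalized (alpha + n%:R) (alpha + n%:R) (l - n)
          * jacobi_normalized (alpha + n%:R) (alpha + n%:R) (m - n)).
Proof.
have hnl := leq_trans hnm hml.
have a_gt0 : 0 < alpha + 1 by lra.
have h_gt0 : 0 < alpha + 2^-1 by lra.
have hh_gt0 : 0 < 2 * alpha + 1 by lra.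
have cl_neq0 : poch (- l%:R : R) n != 0 by rewrite poch_oppn_neq0.
have cm_neq0 : poch (- m%:R : R) n != 0 by rewrite poch_oppn_neq0.
apply: (scalerI (mulf_neq0 cl_neq0 cm_neq0)).
rewrite racah_sum_derivn_prod // /derivn_prod.
have derivl := derivn_jacobi alpha (l - n) n a_gt0; rewrite subnKC // in derivl.
have derivm := derivn_jacobi alpha (m - n) n a_gt0; rewrite subnKC // in derivm.
rewrite {}derivl {}derivm.
set F := jacobi_normalized _ _ _; set G := jacobi_normalized _ _ _.
set a := _ / _; set b := _ / _.
have -> : ('X^2 - 1) ^+ n * (a *: F) * (b *: G)
    = (a * b) *: (('X^2 - 1) ^+ n * F * G).
  by rewrite -!mul_polyC (polyCM a b); ring.
rewrite !scalerA {}/a {}/b; congr (_ *: _).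
have factl : poch (- l%:R) n = (-1) ^+ n * l`!%:R / (l - n)`!%:R :> R.
  by rewrite -poch_oppn_fact // mulfK // fact_neq0.
have factm : poch (- m%:R) n = (-1) ^+ n * m`!%:R / (m - n)`!%:R :> R.
  by rewrite -poch_oppn_fact // mulfK // fact_neq0.
have eqh : 2 * (alpha + 2^-1) = 2 * alpha + 1 by field.
rewrite factl factm /lin_const /lin_coef !subn0 geg_fact0 /geg_fact /geg_ratio.
rewrite eqh (pochD _ l n) (pochD _ m n) [poch _ (l + m).+1]pochSr.
rewrite -[l%:R + 2 * alpha + 1]addrA -[m%:R + 2 * alpha + 1]addrA.
rewrite ![_ + (2 * alpha + 1)]addrC mul2n -addnn exprD.
have sgn2 : (-1) ^+ n * (-1) ^+ n = 1 :> R by rewrite -expr2 sqrr_sign.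
move: ((-1) ^+ n) sgn2 => s sgn2.
(* The two conversions of (-l)_n and (-m)_n put s^2 on one side only; inserting s^2 = 1 on the other
   makes this an identity of rational functions. *)
set L : R := (X in X = _); rewrite -[L]mul1r -[X in X * L]sgn2 /L.
field.
(* This denominator is twice l+m+h. *)
rewrite (_ : _ + _ * 2 = 2 * alpha + 1 + ((l + m) * 2)%N%:R); last first.
  by rewrite natrM natrD; ring.
have last_gt0 : 0 < 2 * alpha + 1 + ((l + m) * 2)%N%:R by rewrite ltr_wpDr.
by rewrite !fact_neq0 !gt_eqF ?poch_gt0 ?exprn_gt0.
Qed.
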